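(* Let $\mathcal{X}\subset\mathbb{R}^D$, let $\mathcal{D}$ be a probability distribution on $\mathcal{X}$, and let $\mathcal{S}=\{\mathbf{x}_1,\dots,\mathbf{x}_n\}$ consist of $n$ i.i.d. samples from $\mathcal{D}$. Let $N_\phi,N_\theta$ be positive integers and let $\ell:\mathbb{R}^{N_\phi}\times\mathbb{R}^{N_\theta}\times\mathcal{X}\to[0,1]$ be a measurable loss. Define $R(\phi,\theta)=\mathbb{E}_{\mathbf{x}\sim\mathcal{D}}[\ell(\phi,\theta,\mathbf{x})]$ and $\widehat{R}_{\mathcal{S}}(\phi,\theta)=\frac1n\sum_{i=1}^n\ell(\phi,\theta,\mathbf{x}_i)$. Let $\delta\in(0,1)$, fix $\phi^0\in\mathbb{R}^{N_\phi}$, $\theta^0\in\mathbb{R}^{N_\theta}$ and $\sigma_\phi^2>0$, $\sigma_\theta^2>0$ (all chosen independently of $\mathcal{S}$). Then with probability at least $1-\delta$ over $\mathcal{S}\sim\mathcal{D}^n$, simultaneously for all $\phi\in\mathbb{R}^{N_\phi}$, $\theta\in\mathbb{R}^{N_\theta}$, $s_\phi^2>0$, $s_\theta^2>0$, \begin{align*} \mathbb{E}_{\tilde\phi\sim\mathcal{N}(\phi,s^2_\phi I),\,\tilde\theta\sim\mathcal{N}(\theta,s^2_\theta I)}[R(\tilde\phi,\tilde\theta)] &\leq \mathbb{E}_{\tilde\phi\sim\mathcal{N}(\phi,s^2_\phi I),\,\tilde\theta\sim\mathcal{N}(\theta,s^2_\theta I)}[\widehat{R}_{\mathcal{S}}(\tilde\phi,\tilde\theta)]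 \\ &\quad + \sqrt{\frac{\|\phi-\phi^0\|_2^2}{4\sigma^2_\phi n} +\frac{N_\phi\left(\frac{s^2_\phi}{\sigma^2_\phi} + \log\frac{\sigma_\phi^2}{s_\phi^2} - 1\right)}{4n} + \frac{\log\frac{2\sqrt{n}}{\delta}}{2n}} \\ &\quad + \sqrt{\frac{\|\theta-\theta^0\|_2^2}{4\sigma^2_\theta n} +\frac{N_\theta\left(\frac{s^2_\theta}{\sigma^2_\theta} + \log\frac{\sigma_\theta^2}{s_\theta^2} - 1\right)}{4n} + \frac{\log\frac{2\sqrt{n}}{\delta}}{2n}} . \end{align*}
   Context: In the paper $\phi$ and $\theta$ are the weight vectors of the encoder and decoder neural networks of a (pseudo-)variational autoencoder, $N_\phi$ and $N_\theta$ are the numbers of weights of these networks, and $\ell(\phi,\theta,\mathbf{x})$ is a rescaled, truncated reconstruction loss $-\mathbb{E}_{q_\phi(\mathbf{z}|\mathbf{x})}[\log p_\theta(\mathbf{x}|\mathbf{z})]$ taking values in $[0,1]$; only boundedness in $[0,1]$ and measurability are used. $\mathcal{N}(m,s^2I)$ denotes the isotropic Gaussian with mean $m$ and covariance $s^2I$ in the appropriate dimension; the expectations are over independent $\tilde\phi,\tilde\theta$. *)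

(* Defs.v *)
From HB Require Import structures.
From mathcomp Require Import all_boot all_order all_algebra.
From mathcomp Require Import all_classical all_reals all_analysis.
Set Implicit Arguments. Unset Strict Implicit. Unset Printing Implicit Defensive.
Import Order.TTheory GRing.Theory Num.Theory.
Local Open Scope classical_set_scope.
Local Open Scope ring_scope.
Local Open Scope ereal_scope.

(* Iterated integral over n.-tuple T against the product of the measures
   mu 0, mu 1, ..., mu (n-1) (coordinate i is integrated against mu i):
     iint n mu f = \int[mu 0]_x0 ... \int[mu (n-1)]_x(n-1) f [x0; ...; x(n-1)].
   For nonnegative measurable f this is the integral of f against the
   product measure (Tonelli). *)
Fixpoint iint d (T : measurableType d) (R : realType) (n : nat)
  (mu : nat -> {measure set T -> \bar R}) : (n.-tuple T -> \bar R) -> \bar R :=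
  match n return (n.-tuple T -> \bar R) -> \bar R with
  | 0 => fun f => f [tuple]
  | n'.+1 => fun f =>
      \int[mu 0%N]_x iint (fun k => mu k.+1) (fun t => f (cons_tuple x t))
  end.

(* Expectation of f(xt) for xt ~ N(m, s^2 I) on R^N  (s = standard deviation). *)
Definition gauss_exp (R : realType) (N : nat) (m : N.-tuple R) (s : R)
  (f : N.-tuple R -> \bar R) : \bar R :=
  iint (fun k => normal_prob (nth 0%R m k) s) f.

Definition sample_exp d (T : measurableType d) (R : realType)
  (P : probability T R) (n : nat) (f : n.-tuple T -> \bar R) : \bar R :=
  iint (fun _ => P) f.

Definition sample_prob d (T : measurableType d) (R : realType)
  (P : probability T R) (n : nat) (A : set (n.-tuple T)) : \bar R :=
  sample_exp P (fun S => (\1_A S)%:E).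

Definition sqdist (R : realType) (N : nat) (u v : N.-tuple R) : R :=
  (\sum_(i < N) (tnth u i - tnth v i) ^+ 2)%R.

Definition cterm (R : realType) (N n : nat) (w w0 : N.-tuple R)
  (s sig delta : R) : R :=
  Num.sqrt (sqdist w w0 / (4 * sig ^+ 2 * n%:R)
            + N%:R * (s ^+ 2 / sig ^+ 2 + ln (sig ^+ 2 / s ^+ 2) - 1) / (4 * n%:R)
            + ln (2 * Num.sqrt n%:R / delta) / (2 * n%:R))%R.

(* Population risk R(phi,theta) = E_{x ~ P}[loss phi theta x]; P lives on X. *)
Definition risk (R : realType) (D Np Nt : nat) (P : probability (D.-tuple R) R)
  (X : set (D.-tuple R)) (loss : Np.-tuple R -> Nt.-tuple R -> D.-tuple R -> R)
  (p : Np.-tuple R) (q : Nt.-tuple R) : \bar R :=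
  \int[P]_(x in X) (loss p q x)%:E.

Definition emp_risk (R : realType) (D Np Nt n : nat)
  (loss : Np.-tuple R -> Nt.-tuple R -> D.-tuple R -> R)
  (S : n.-tuple (D.-tuple R)) (p : Np.-tuple R) (q : Nt.-tuple R) : \bar R :=
  ((n%:R)^-1 * \sum_(i < n) loss p q (tnth S i))%R%:E.

(* Main.v *)
(** The two square roots leave a large slack: each is at least
    sqrt (L / (2n)) with L = ln (2 sqrt n / delta), so their sum dominates
    sqrt ((K1 + K2 + 4L) / (2n)), where K1 and K2 are the two Gaussian
    Kullback-Leibler divergences.  The coefficient of K1 + K2 must be sharp
    but that of L need not be, so Maurer's bound on the kl-moment can be avoided:
    Hoeffding's lemma bounds the exponential moments of the deviation for
    lam = 4 j, j = 1..n, a union over this grid (Markov's inequality for the sum)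
    costs ln n, and the Donsker-Varadhan inequality transfers the bound
    from the prior to all posteriors at once. *)
Require Import Defs.
From HB Require Import structures.
From mathcomp Require Import all_boot all_order all_algebra.
From mathcomp Require Import all_classical all_reals all_analysis.
From mathcomp Require Import measurable_realfun ring lra.
Import Order.TTheory GRing.Theory Num.Theory.
Local Open Scope classical_set_scope.
Local Open Scope ring_scope.

(** * Products of probabilities on tuples *)

(** The factor [lam] has to be fixed before the sample is drawn, whereas the best one depends on the
    mean deviation under the posterior, hence on both [S] and [Q]; this forces a grid instead of a
    single exponential moment. The sharpness needed for [K1 + K2] comes from [cterm]: its first two
    terms are a Gaussian divergence divided by [2n], so the target is [2 n x^2 <= K1 + K2 + ...] for
    the mean deviation [x], and the factor 2 there corresponds exactly to the constant 1/8 of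
    Hoeffding's lemma. Divergences are handled through explicit log-densities with an upper bound on
    their mean. This form passes to products and to injective images, so Gaussians on tuples reduce
    to one coordinate. The mean and variance of a Gaussian are not computed by integration either:
    they are deduced from the total mass 1 of all Gaussian densities and from [e^y >= 1 + y]. *)

Definition consT d (T : measurableType d) (n : nat) (z : T * n.-tuple T) :
  n.+1.-tuple T := [tuple of z.1 :: z.2].

Arguments consT {d T n} z.

Definition unconsT d (T : measurableType d) (n : nat) (t : n.+1.-tuple T) :
  T * n.-tuple T := (thead t, [tuple of behead t]).

Arguments unconsT {d T n} t.

Lemma consTK d (T : measurableType d) n : cancel (@consT d T n) (@unconsT d T n).
Proof.
move=> [x t]; rewrite /consT /unconsT theadE; congr (_, _).
exact/val_inj.
Qed.

Lemma measurable_consT d (T : measurableType d) n :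
  measurable_fun setT (@consT d T n).
Proof. exact: (@measurable_cons _ _ _ _ fst n snd). Qed.

Lemma measurable_unconsT d (T : measurableType d) n :
  measurable_fun setT (@unconsT d T n).
Proof.
apply/measurable_fun_pairP; split; last exact: measurable_behead.
exact: measurable_tnth.
Qed.

HB.instance Definition _ d (T : measurableType d) n :=
  isMeasurableFun.Build _ _ _ _ (@consT d T n) (@measurable_consT d T n).

(** The recursion follows that of [iint], so that Tonelli identifies the two in [iintE]. The factors
    vary with the coordinate because those of a Gaussian have different means. Being the image under
    [consT] of a binary product, the measure inherits divergence bounds from [kl_le_prod] and
    [kl_le_distribution]. *)
Fixpoint tuple_prob d (T : measurableType d) (R : realType) (n : nat)
    (mu : nat -> probability T R) : probability (n.-tuple T) R :=
  match n with
  | 0 => dirac ([tuple] : 0.-tuple T)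
  | n'.+1 => distribution (mu 0%N \x tuple_prob d T R n' (fun k => mu k.+1))%E
               (@consT d T n')
  end.
Arguments tuple_prob {d T R} n mu.

Section tuple_prob_theory.
Context d (T : measurableType d) (R : realType).
Local Open Scope ereal_scope.
Implicit Type mu : nat -> probability T R.

Lemma ge0_integral_tuple_probS n mu (f : n.+1.-tuple T -> \bar R) :
  measurable_fun [set: n.+1.-tuple T] f -> (forall t, 0 <= f t) ->
  \int[tuple_prob n.+1 mu]_t f t =
  \int[mu 0%N]_x \int[tuple_prob n (fun k => mu k.+1)]_t f (consT (x, t)).
Proof.
move=> mf f0; rewrite /= ge0_integral_distribution//=.
rewrite fubini_tonelli1//=.
by apply: measurableT_comp => //; exact: measurable_consT.
Qed.

Lemma iintE n mu (f : n.-tuple T -> \bar R) :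
  measurable_fun [set: n.-tuple T] f -> (forall t, 0 <= f t) ->
  iint (fun k => mu k) f = \int[tuple_prob n mu]_t f t.
Proof.
elim: n mu f => [|n IHn] mu f mf f0.
  by rewrite /= integral_dirac// diracT mul1e.
rewrite ge0_integral_tuple_probS//=; apply: eq_integral => x _.
rewrite (IHn (fun k => mu k.+1))//.
apply: (measurableT_comp mf).
by apply: measurable_cons => //; exact: measurable_id.
Qed.

End tuple_prob_theory.

(** * Kullback-Leibler bounds and change of measure *)

(* A bound on the Kullback-Leibler divergence KL(Q || P0), witnessed by
   the log-density r = ln (dQ/dP0) under which P0 has Q-density exp(-r). *)
Definition kl_le d (T : measurableType d) (R : realType)
    (P0 Q : probability T R) (K : R) :=
  exists r : T -> R,
    [/\ measurable_fun setT r,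
        (forall g : T -> \bar R, measurable_fun setT g ->
          (forall x, (0 <= g x)%E) ->
          (\int[P0]_x g x = \int[Q]_x (g x * (expR (- r x))%:E))%E),
        Q.-integrable setT (EFin \o r) &
        (\int[Q]_x (r x)%:E <= K%:E)%E].

Arguments kl_le {d T R} P0 Q K.

Section kl_le_theory.
Local Open Scope ereal_scope.

Lemma integral_probability_cst d (T : measurableType d) (R : realType)
  (P : probability T R) (c : \bar R) : \int[P]__ c = c.
Proof. by rewrite integral_cst//= probability_setT mule1. Qed.

Lemma kl_le_refl d (T : measurableType d) (R : realType)
  (P : probability T R) : kl_le P P 0.
Proof.
exists (fun=> 0%R); split.
- exact: measurable_cst.
- by move=> g mg g0; apply: eq_integral => x _; rewrite oppr0 expR0 mule1.
- exact: finite_measure_integrable_cst.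
- by rewrite integral_cst// mul0e.
Qed.

Lemma measurable_mul_expRN d (T : measurableType d) (R : realType)
    (g : T -> \bar R) (r : T -> R) :
  measurable_fun setT g -> measurable_fun setT r ->
  measurable_fun setT (fun x => g x * (expR (- r x))%:E).
Proof.
move=> mg mr; apply: emeasurable_funM => //.
apply/measurable_EFinP; apply: measurableT_comp => //.
exact: measurableT_comp.
Qed.

Lemma mul_expR_ge0 (R : realType) (x : \bar R) (y : R) :
  0 <= x -> 0 <= x * (expR y)%:E.
Proof. by move=> x0; rewrite mule_ge0// lee_fin expR_ge0. Qed.

(** Log-densities of independent factors add up: Tonelli lets the two changes of measure act one
    variable at a time, and each [r] has the same mean under the product as under its own factor. *)
Lemma kl_le_prod d1 d2 (T1 : measurableType d1) (T2 : measurableType d2)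
    (R : realType) (P1 Q1 : probability T1 R) (P2 Q2 : probability T2 R)
    (K1 K2 : R) :
  kl_le P1 Q1 K1 -> kl_le P2 Q2 K2 -> kl_le (P1 \x P2) (Q1 \x Q2) (K1 + K2).
Proof.
move=> [r1 [mr1 c1 i1 k1]] [r2 [mr2 c2 i2 k2]].
have mr1' : measurable_fun setT (fun z : T1 * T2 => r1 z.1).
  exact: measurableT_comp.
have mr2' : measurable_fun setT (fun z : T1 * T2 => r2 z.2).
  exact: measurableT_comp.
have j1 : (Q1 \x Q2).-integrable setT (fun z : T1 * T2 => (r1 z.1)%:E).
  apply/integrable12ltyP; first exact/measurable_EFinP.
  under eq_integral do rewrite /= integral_probability_cst.
  by have /integrableP[] := i1.
have j2 : (Q1 \x Q2).-integrable setT (fun z : T1 * T2 => (r2 z.2)%:E).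
  apply/integrable12ltyP; first exact/measurable_EFinP.
  rewrite /= integral_probability_cst.
  by have /integrableP[] := i2.
exists (fun z => r1 z.1 + r2 z.2)%R; split.
- exact: measurable_funD.
- move=> g mg g0.
  rewrite fubini_tonelli1//.
  transitivity (\int[P1]_x fubini_F Q2
      (fun z => g z * (expR (- r2 z.2))%:E) x).
    apply: eq_integral => x _; rewrite /fubini_F c2//.
    exact: measurableT_comp.
  rewrite c1; last 2 first.
  + apply: measurable_fun_fubini_tonelli_F.
      exact: measurable_mul_expRN.
    by move=> z; rewrite mule_ge0// lee_fin expR_ge0.
  + move=> x; apply: integral_ge0 => y _.
    exact: mul_expR_ge0.
  rewrite fubini_tonelli1; last 2 first.
  + by apply: (@measurable_mul_expRN _ (T1 * T2)%type) => //; exact: measurable_funD.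
  + by move=> z; exact: mul_expR_ge0.
  apply: eq_integral => x _; rewrite /fubini_F -ge0_integralZr//=.
  + apply: eq_integral => y _.
    by rewrite -muleA -EFinM -expRD opprD addrC.
  + apply: measurable_mul_expRN => //.
    exact: measurableT_comp.
  + by move=> y _; exact: mul_expR_ge0.
- exact: (integrableD measurableT j1 j2).
- under eq_integral do rewrite EFinD.
  rewrite integralD//= EFinD leeD//.
  + rewrite -integral12_prod_meas1// /fubini_F/=.
    by under eq_integral do rewrite integral_probability_cst.
  + rewrite -integral12_prod_meas1// /fubini_F/=.
    by rewrite integral_probability_cst.
Qed.

(** The left inverse transports the log-density as [r \o f']; composed with [f] it is [r] again, so
    nothing is lost in the image. *)
Lemma kl_le_distribution d1 d2 (T : measurableType d1) (U : measurableType d2)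
    (R : realType) (P Q : probability T R) (f : {mfun T >-> U}) (f' : U -> T)
    (K : R) :
  measurable_fun setT f' -> cancel f f' ->
  kl_le P Q K -> kl_le (distribution P f) (distribution Q f) K.
Proof.
move=> mf' fK [r [mr c i k]].
have rf'f : (EFin \o (r \o f')) \o f = EFin \o r.
  by apply/funext => x /=; rewrite fK.
have mrf' : measurable_fun setT (r \o f') by exact: measurableT_comp.
have ji : Q.-integrable setT ((EFin \o (r \o f')) \o f) by rewrite rf'f.
exists (r \o f'); split => //.
- move=> g mg g0; rewrite !ge0_integral_distribution//=.
  + rewrite c//; last exact: measurableT_comp.
    by apply: eq_integral => x _ /=; rewrite fK.
  + exact: measurable_mul_expRN.
  + by move=> z; exact: mul_expR_ge0.
- apply: integrable_pushforward => //.
  exact/measurable_EFinP.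
- rewrite -[fun x => _]/(EFin \o (r \o f')) integral_distribution//.
    by rewrite rf'f.
  exact/measurable_EFinP.
Qed.

Lemma kl_le_tuple_prob d (T : measurableType d) (R : realType) (n : nat)
    (mu nu : nat -> probability T R) (K : nat -> R) :
  (forall k, kl_le (mu k) (nu k) (K k)) ->
  kl_le (tuple_prob n mu) (tuple_prob n nu) (\sum_(k < n) K k)%R.
Proof.
elim: n mu nu K => [|n IHn] mu nu K mnK.
  by rewrite big_ord0; exact: kl_le_refl.
rewrite big_ord_recl; apply: kl_le_distribution.
- exact: measurable_unconsT.
- exact: consTK.
- apply: kl_le_prod => //.
  exact: (IHn (fun k => mu k.+1) (fun k => nu k.+1) (fun k => K k.+1)).
Qed.

(* Applying e^u >= e^a (1 + u - a) with a the Q-mean of u = h - r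
   gives Jensen's inequality e^a <= E_Q e^u = E_P0 e^h. *)
Lemma donsker_varadhan d (T : measurableType d) (R : realType)
    (P0 Q : probability T R) (K C : R) (h : T -> R) :
  kl_le P0 Q K -> Q.-integrable setT (EFin \o h) -> (0 < C)%R ->
  \int[P0]_x (expR (h x))%:E <= C%:E ->
  \int[Q]_x (h x)%:E <= (K + ln C)%:E.
Proof.
move=> [r [mr c ir k]] ih C0 hC.
have mh : measurable_fun setT h.
  by apply/measurable_EFinP; exact: measurable_int ih.
have hB : \int[Q]_x (h x - r x)%:E = \int[Q]_x (h x)%:E - \int[Q]_x (r x)%:E.
  by rewrite -integralB_EFin.
have iu : Q.-integrable setT (fun x => (h x - r x)%:E).
  exact: (integrableB measurableT ih ir).
set a := fine (\int[Q]_x (h x - r x)%:E).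
have aE : \int[Q]_x (h x - r x)%:E = a%:E by rewrite fineK// integrable_fin_num.
have : (expR a)%:E <= C%:E.
  apply: (le_trans _ hC); rewrite c//; last first.
    by apply/measurable_EFinP; exact: measurableT_comp.
  have ia : Q.-integrable setT (cst (1 - a)%:E).
    exact: finite_measure_integrable_cst.
  have ii : Q.-integrable setT (fun x => (1 - a)%:E + (h x - r x)%:E).
    exact: (integrableD measurableT ia iu).
  rewrite -[leLHS]mule1 -[1](_ : \int[Q]_x ((1 - a)%:E + (h x - r x)%:E) = 1).
    rewrite -integralZl//; apply: le_integral => //.
    + exact: integrableZl.
    (* Integrability of [e^(h - r)] under [Q] is the change of measure read backwards: its integral
       is that of [e^h] under [P0], at most [C]. *)
    + apply/integrableP; split.
        apply: measurable_mul_expRN => //.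
        by apply/measurable_EFinP; exact: measurableT_comp.
      under eq_integral do rewrite -EFinM gee0_abs ?lee_fin ?mulr_ge0 ?expR_ge0// EFinM.
      rewrite -c//; first exact: (le_lt_trans hC (ltry _)).
      by apply/measurable_EFinP; exact: measurableT_comp.
    + move=> x _; rewrite -!EFinM lee_fin -expRD.
      rewrite (_ : h x - r x = a + (h x - r x - a))%R; last by lra.
      rewrite expRD ler_wpM2l ?expR_ge0//.
      apply: le_trans (expR_ge1Dx _); lra.
  rewrite integralD//= aE integral_probability_cst -EFinD.
  by rewrite subrK.
rewrite lee_fin => aC.
have aln : (a <= ln C)%R by rewrite -ler_expR lnK.
have rfin : \int[Q]_x (r x)%:E \is a fin_num by exact: integrable_fin_num.
have : \int[Q]_x (h x)%:E = a%:E + \int[Q]_x (r x)%:E.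
  by rewrite -aE hB subeK.
by move=> ->; rewrite addrC EFinD leeD// lee_fin.
Qed.
End kl_le_theory.

(** * Gaussian measures *)

Section integral_density.
Local Open Scope ereal_scope.
Context d (T : measurableType d) (R : realType).
Variables (mu nu : {measure set T -> \bar R}) (g : T -> R).
Hypotheses (mg : measurable_fun setT g) (g0 : forall x, (0 <= g x)%R).
Hypothesis nuE :
  forall A, measurable A -> nu A = \int[mu]_(x in A) (g x)%:E.

Import HBNNSimple.

Lemma integral_density_nnsfun (h : {nnsfun T >-> R}) :
  \int[nu]_x (h x)%:E = \int[mu]_x ((h x)%:E * (g x)%:E).
Proof.
have mgE : measurable_fun setT (EFin \o g) by exact/measurable_EFinP.
under [LHS]eq_integral do rewrite fimfunE -fsumEFin//.
rewrite [LHS]ge0_integral_fsum//; last 2 first.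
  - by move=> r; exact/measurable_EFinP/measurableT_comp.
  - by move=> n x _; rewrite EFinM nnfun_muleindic_ge0.
under [RHS]eq_integral.
  move=> x _; rewrite fimfunE -fsumEFin// muleC ge0_mule_fsumr; last first.
    by move=> r; rewrite EFinM nnfun_muleindic_ge0.
  over.
rewrite [RHS]ge0_integral_fsum//; last 2 first.
  - move=> r; apply: emeasurable_funM => //.
    by apply/measurable_EFinP; exact: measurableT_comp.
  - move=> n x _; apply: mule_ge0; first by rewrite lee_fin.
    by rewrite EFinM nnfun_muleindic_ge0.
apply: eq_fsbigr => r; rewrite inE => -[y _ <-{r}].
rewrite integralZl_indic_nnsfun// integral_indic// setIT nuE//.
under [RHS]eq_integral do rewrite EFinM muleCA.
rewrite ge0_integralZl//.
- congr (_ * _); rewrite integral_mkcond; apply: eq_integral => x _.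
  by rewrite epatch_indic.
- by apply: emeasurable_funM => //; exact/measurable_EFinP.
- by move=> x _; rewrite mule_ge0// lee_fin.
- by rewrite lee_fin.
Qed.

(** Monotone convergence along simple approximations, on both sides, extends the identity from sets
    to functions. *)
Lemma ge0_integral_density (f : T -> \bar R) :
  measurable_fun setT f -> (forall x, 0 <= f x) ->
  \int[nu]_x f x = \int[mu]_x (f x * (g x)%:E).
Proof.
move=> mf f0; pose f_ := nnsfun_approx measurableT mf.
have cvf x : EFin \o f_^~ x @ \oo --> f x by exact: cvg_nnsfun_approx.
have ndf x : {homo f_^~ x : a b / (a <= b)%N >-> (a <= b)%R}.
  by move=> a b ab; exact/lefP/nd_nnsfun_approx.
transitivity (limn (fun n => \int[nu]_x (f_ n x)%:E)).
  rewrite -monotone_convergence//=.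
  - by apply: eq_integral => x _; apply/esym/cvg_lim => //; exact: cvf.
  - by move=> n; exact/measurable_EFinP.
  - by move=> n x _; rewrite lee_fin.
  - by move=> x _ a b ab; rewrite lee_fin ndf.
under eq_fun do rewrite integral_density_nnsfun.
rewrite -monotone_convergence//=.
- apply: eq_integral => x _; apply/cvg_lim => //.
  apply: cvgeZr => //; exact: cvf.
- move=> n; apply: emeasurable_funM => //; exact/measurable_EFinP.
- by move=> n x _; rewrite mule_ge0// lee_fin.
- by move=> x _ a b ab; rewrite lee_wpmul2r ?lee_fin// ndf.
Qed.

End integral_density.

(** Log-likelihood ratio of N(m, s^2) against N(m0, sigma^2); the common factor [sqrt (2 pi)] has
    cancelled. *)
Definition normal_log_ratio (R : realType) (m0 sigma m s x : R) : R :=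
  ln sigma - ln s - (x - m) ^+ 2 / (2 * s ^+ 2) + (x - m0) ^+ 2 / (2 * sigma ^+ 2).
Arguments normal_log_ratio {R} m0 sigma m s x.

Section normal_change.
Context (R : realType).
Implicit Types m s sigma x : R.

Lemma normal_peak_pos s : 0 < s ->
  normal_peak s = s^-1 * (Num.sqrt (pi *+ 2))^-1.
Proof.
move=> s0; rewrite /normal_peak -mulrnAr sqrtrM ?sqr_ge0// sqrtr_sqr.
by rewrite gtr0_norm// invfM.
Qed.

Lemma normal_pdf_ratio m0 sigma m s x : 0 < sigma -> 0 < s ->
  normal_pdf m0 sigma x =
  normal_pdf m s x * expR (- normal_log_ratio m0 sigma m s x).
Proof.
move=> sigma0 s0; rewrite !normal_pdfE ?gt_eqF// !normal_peak_pos// /normal_fun.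
have -> : sigma^-1 = s^-1 * expR (ln s - ln sigma).
  by rewrite expRB !lnK ?posrE// mulrA mulVf ?mul1r// gt_eqF.
rewrite -!mulrA (mulrCA (expR _)); congr (_ * (_ * _)); rewrite -!expRD.
congr expR; rewrite /normal_log_ratio -[s ^+ 2 *+ 2]mulr_natl -[sigma ^+ 2 *+ 2]mulr_natl.
by rewrite !mulNr; ring.
Qed.

Local Open Scope ereal_scope.
Let T := measurableTypeR R.

Lemma measurable_normal_log_ratio m0 sigma m s :
  measurable_fun [set: T] (normal_log_ratio m0 sigma m s).
Proof.
apply: measurable_funD; first apply: measurable_funB => //.
  by apply: measurable_funM => //; apply: measurable_funX; exact: measurable_funB.
by apply: measurable_funM => //; apply: measurable_funX; exact: measurable_funB.
Qed.

Lemma ge0_integral_normal_prob m s (f : T -> \bar R) :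
  measurable_fun [set: T] f -> (forall x, 0 <= f x) ->
  \int[normal_prob m s]_x f x =
  \int[lebesgue_measure]_x (f x * (normal_pdf m s x)%:E).
Proof.
apply: ge0_integral_density => //; first exact: measurable_normal_pdf.
exact: normal_pdf_ge0.
Qed.

Lemma normal_change m0 sigma m s (f : T -> \bar R) :
  (0 < sigma)%R -> (0 < s)%R ->
  measurable_fun [set: T] f -> (forall x, 0 <= f x) ->
  \int[normal_prob m0 sigma]_x f x =
  \int[normal_prob m s]_x (f x * (expR (- normal_log_ratio m0 sigma m s x))%:E).
Proof.
move=> sigma0 s0 mf f0.
rewrite [LHS]ge0_integral_normal_prob// [RHS]ge0_integral_normal_prob.
- apply: eq_integral => x _.
  by rewrite (normal_pdf_ratio m0 sigma m s)// -muleA -EFinM [in RHS]mulrC.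
- apply: measurable_mul_expRN => //; exact: measurable_normal_log_ratio.
- by move=> x; exact: mul_expR_ge0.
Qed.

(** The total mass of N(m0, sigma^2) seen from N(m, s^2). Letting [m0] and [sigma] vary, this
    identity is the source of everything proved below about Gaussian moments. *)
Lemma integral_normal_change m0 sigma m s : (0 < sigma)%R -> (0 < s)%R ->
  \int[normal_prob m s]_x (expR (- normal_log_ratio m0 sigma m s x))%:E = 1.
Proof.
move=> sigma0 s0; rewrite -[RHS](@integral_probability_cst _ _ _ (normal_prob m0 sigma)).
by rewrite (normal_change m0 sigma m s)//; apply: eq_integral => x _; rewrite mul1e.
Qed.

(* A second moment is dominated by the exponential change to N(m, 2 s^2). *)
Lemma normal_integrable_sqr m s : (0 < s)%R ->
  (normal_prob m s).-integrable [set: T] (fun x => ((x - m) ^+ 2)%:E).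
Proof.
move=> s0; pose sg := (Num.sqrt 2 * s)%R.
have sg0 : (0 < sg)%R by rewrite mulr_gt0// sqrtr_gt0.
have mx : measurable_fun [set: T] (fun x : T => ((x - m) ^+ 2)%R).
  by apply: measurable_funX; exact: measurable_funB.
(* The last factor cancels the scale term of the log-ratio. With variance [2 s^2] the dominating
   function becomes [4 s^2 e^(y^2 / (4 s^2))] for [y = x - m], which is at least [y^2]. *)
pose c := (4 * s ^+ 2 * expR (ln sg - ln s))%R.
apply: (@le_integrable _ T R (normal_prob m s) setT measurableT _
   (fun x : T => (c * expR (- normal_log_ratio m sg m s x))%:E)).
- exact/measurable_EFinP.
- move=> x _; rewrite !gee0_abs ?lee_fin ?sqr_ge0//; last first.
    by rewrite mulr_ge0 ?expR_ge0// !mulr_ge0 ?expR_ge0// ltW.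
  have c40 : (0 < 4 * s ^+ 2)%R by rewrite mulr_gt0// exprn_gt0.
  rewrite /c -(mulrA (4 * s ^+ 2)%R) -expRD -ler_pdivrMl//.
  rewrite /normal_log_ratio /sg exprMn sqr_sqrtr//.
  set y := (x - m)%R.
  apply: (@le_trans _ _ (1 + (4 * s ^+ 2)^-1 * y ^+ 2))%R; first by rewrite lerDr.
  apply: le_trans (expR_ge1Dx _) _.
  by rewrite ler_expR le_eqVlt; apply/orP; left; apply/eqP; field; rewrite gt_eqF.
- under eq_fun do rewrite EFinM.
  apply: integrableZl => //.
  apply/integrableP; split.
    apply/measurable_EFinP; apply: measurableT_comp => //.
    by apply: measurableT_comp => //; exact: measurable_normal_log_ratio.
  under eq_integral do rewrite gee0_abs ?lee_fin ?expR_ge0//.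
  by rewrite integral_normal_change// ltry.
Qed.

End normal_change.

Section normal_moments.
Context (R : realType) (m s : R).
Hypothesis s0 : 0 < s.
Local Open Scope ereal_scope.
Let T := measurableTypeR R.
Let Q : probability T R := normal_prob m s.
Let M1 := fine (\int[Q]_x (x - m)%:E).
Let M2 := fine (\int[Q]_x ((x - m) ^+ 2)%:E).

Let i2 : Q.-integrable [set: T] (fun x : T => ((x - m) ^+ 2)%:E).
Proof. exact: normal_integrable_sqr. Qed.

Let i1 : Q.-integrable [set: T] (fun x : T => (x - m)%:E).
Proof.
have i12 : Q.-integrable [set: T] (fun x : T => 1%:E + ((x - m) ^+ 2)%:E).
  by apply: (integrableD measurableT _ i2); exact: finite_measure_integrable_cst.
apply: (@le_integrable _ T R Q setT measurableT _ _ _ _ i12).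
  by apply/measurable_EFinP; exact: measurable_funB.
move=> x _; rewrite -EFinD /= lee_fin [leRHS]ger0_norm ?addr_ge0 ?sqr_ge0//.
rewrite -(real_normK (num_real (x - m))).
by have := sqr_ge0 (`|x - m| - 1)%R; have := normr_ge0 (x - m)%R; nra.
Qed.

Let quadE (a b c : R) :
  Q.-integrable [set: T]
    (fun x : T => (a + b * (x - m) + c * (x - m) ^+ 2)%:E) /\
  \int[Q]_x (a + b * (x - m) + c * (x - m) ^+ 2)%:E = (a + b * M1 + c * M2)%:E.
Proof.
have ja : Q.-integrable [set: T] (fun=> a%:E).
  exact: finite_measure_integrable_cst.
have jb : Q.-integrable [set: T] (fun x : T => b%:E * (x - m)%:E).
  exact: (integrableZl measurableT b i1).
have jc : Q.-integrable [set: T] (fun x : T => c%:E * ((x - m) ^+ 2)%:E).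
  exact: (integrableZl measurableT c i2).
have jab : Q.-integrable [set: T] (fun x : T => a%:E + b%:E * (x - m)%:E).
  exact: (integrableD measurableT ja jb).
split; first exact: (integrableD measurableT jab jc).
under eq_integral do rewrite EFinD EFinD EFinM (EFinM c).
rewrite integralD// integralD// integralZl// integralZl//.
rewrite integral_probability_cst /M1 /M2 !EFinD !EFinM !fineK//.
- exact: integrable_fin_num.
- exact: integrable_fin_num.
Qed.

Let log_ratioE m0 sigma (x : R) : (0 < sigma)%R ->
  normal_log_ratio m0 sigma m s x =
  (ln sigma - ln s + (m - m0) ^+ 2 / (2 * sigma ^+ 2)
   + (m - m0) / sigma ^+ 2 * (x - m)
   + ((2 * sigma ^+ 2)^-1 - (2 * s ^+ 2)^-1) * (x - m) ^+ 2)%R.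
Proof.
by move=> sigma0; rewrite /normal_log_ratio; field; rewrite !gt_eqF.
Qed.

(* The exponential of minus the log-ratio has mean 1, so e^y >= 1 + y makes the
   mean log-ratio nonnegative for every alternative Gaussian; as the mean and
   the scale of the alternative vary this pins down the two moments. *)
Let gap_ge0 m0 sigma : (0 < sigma)%R ->
  (0 <= ln sigma - ln s + (m - m0) ^+ 2 / (2 * sigma ^+ 2)
   + (m - m0) / sigma ^+ 2 * M1
   + ((2 * sigma ^+ 2)^-1 - (2 * s ^+ 2)^-1) * M2)%R.
Proof.
move=> sigma0; set a := (_ - _ + _)%R; set b := (_ / _)%R; set c := (_^-1 - _)%R.
have [_ qE] := quadE (1 - a) (- b) (- c).
have [qi _] := quadE (1 - a) (- b) (- c).
suff : (1 - a + - b * M1 + - c * M2)%:E <= 1%:E by rewrite lee_fin; lra.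
rewrite -qE -[leRHS](@integral_normal_change R m0 sigma m s)//.
apply: le_integral => //.
  apply/integrableP; split.
    apply/measurable_EFinP; apply: measurableT_comp => //.
    by apply: measurableT_comp => //; exact: measurable_normal_log_ratio.
  under eq_integral do rewrite gee0_abs ?lee_fin ?expR_ge0//.
  by rewrite integral_normal_change// ltry.
move=> x _; rewrite lee_fin; apply: le_trans (expR_ge1Dx _).
by rewrite log_ratioE// -/a -/b -/c; lra.
Qed.

(** For [sigma = s] the scale terms of [gap_ge0] vanish and a quadratic in the shift [d] remains; at
    its minimiser [d = - M1] it equals [- M1^2 / (2 s^2)]. *)
Lemma normal_mean : M1 = 0%R.
Proof.
have H d : (0 <= d ^+ 2 / (2 * s ^+ 2) + d / s ^+ 2 * M1)%R.
  have := gap_ge0 (m - d)%R s s0.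
  have -> : (m - (m - d) = d)%R by ring.
  by rewrite !subrr mul0r add0r addr0.
have s20 : (0 < s ^+ 2)%R by rewrite exprn_gt0.
have := H (- M1)%R; rewrite sqrrN.
rewrite (_ : _ + _ = - (M1 ^+ 2 / (2 * s ^+ 2)))%R; last by field; rewrite gt_eqF.
rewrite oppr_ge0 pmulr_lle0 ?invr_gt0 ?mulr_gt0// => M10.
by apply/eqP; rewrite -sqrf_eq0 eq_le M10 sqr_ge0.
Qed.

(** Here the alternative keeps the mean and has scale [s / v]. The resulting
    [2 ln v <= c (v^2 - 1)], optimised over [v], gives [c - 1 <= ln c], which the strict inequality
    [1 + y < e^y] for [y != 0] allows only at [c = 1]. *)
Lemma normal_second_moment : M2 = (s ^+ 2)%R.
Proof.
have s20 : (0 < s ^+ 2)%R by rewrite exprn_gt0.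
pose c := (M2 / s ^+ 2)%R.
have H (v : R) : (0 < v -> ln v *+ 2 <= c * (v ^+ 2 - 1))%R.
  move=> v0; have sv0 : (0 < s / v)%R by rewrite divr_gt0.
  have := gap_ge0 m (s / v)%R sv0.
  rewrite subrr expr0n/= mul0r mul0r mul0r addr0 !addr0 ln_div ?posrE//.
  rewrite (_ : _ + _ = (c * (v ^+ 2 - 1) - ln v *+ 2) / 2)%R; last first.
    by rewrite /c; field; rewrite !gt_eqF.
  by rewrite pmulr_lge0 ?invr_gt0// subr_ge0.
have c0 : (0 < c)%R.
  have := H 2%R (ltr0Sn R 1); have l2 : (0 < ln (2 : R))%R by rewrite ln_gt0// ltr1n.
  by move=> h; rewrite ltNge; apply/negP => c0; nra.
have Hc : (c - 1 <= ln c)%R.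
  (* [v = sqrt (1 / c)] minimises [c (v^2 - 1) - 2 ln v]; positivity of [c] was obtained from
     [v = 2]. *)
  have sc0 : (0 < Num.sqrt c^-1)%R by rewrite sqrtr_gt0 invr_gt0.
  have := H _ sc0; rewrite -lnXn// sqr_sqrtr; last by rewrite invr_ge0 ltW.
  rewrite lnV ?posrE//.
  by rewrite mulrBr divff ?gt_eqF//; lra.
suff c1 : c = 1%R by rewrite -[LHS](divfK (lt0r_neq0 s20)) -/c c1 mul1r.
apply/eqP/negPn/negP => c1.
have lc : ln c != 0%R by rewrite ln_eq0.
have := expR_gt1Dx lc; rewrite lnK ?posrE//; lra.
Qed.

Lemma normal_log_ratio_integral m0 sigma : (0 < sigma)%R ->
  Q.-integrable [set: T] (EFin \o normal_log_ratio m0 sigma m s) /\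
  \int[Q]_x (normal_log_ratio m0 sigma m s x)%:E =
  ((m - m0) ^+ 2 / (2 * sigma ^+ 2)
   + (s ^+ 2 / sigma ^+ 2 + ln (sigma ^+ 2 / s ^+ 2) - 1) / 2)%:E.
Proof.
move=> sigma0.
have -> : EFin \o normal_log_ratio m0 sigma m s = (fun x =>
  (ln sigma - ln s + (m - m0) ^+ 2 / (2 * sigma ^+ 2)
   + (m - m0) / sigma ^+ 2 * (x - m)
   + ((2 * sigma ^+ 2)^-1 - (2 * s ^+ 2)^-1) * (x - m) ^+ 2)%:E).
  by apply/funext => x /=; rewrite log_ratioE.
under eq_integral do rewrite log_ratioE//.
have [qi ->] := quadE (ln sigma - ln s + (m - m0) ^+ 2 / (2 * sigma ^+ 2))
  ((m - m0) / sigma ^+ 2) ((2 * sigma ^+ 2)^-1 - (2 * s ^+ 2)^-1).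
split => //; rewrite normal_mean normal_second_moment.
rewrite ln_div ?posrE ?exprn_gt0// !lnXn//; congr EFin.
by field; rewrite !gt_eqF.
Qed.

End normal_moments.

Lemma kl_le_normal (R : realType) (m0 sigma m s : R) : 0 < sigma -> 0 < s ->
  kl_le (normal_prob m0 sigma : probability (measurableTypeR R) R)
    (normal_prob m s)
    ((m - m0) ^+ 2 / (2 * sigma ^+ 2)
     + (s ^+ 2 / sigma ^+ 2 + ln (sigma ^+ 2 / s ^+ 2) - 1) / 2).
Proof.
move=> sigma0 s0; have [qi qE] := @normal_log_ratio_integral R m s s0 m0 sigma sigma0.
exists (normal_log_ratio m0 sigma m s); split.
- exact: measurable_normal_log_ratio.
- by move=> g mg g0; exact: normal_change.
- exact: qi.
- by rewrite qE lexx.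
Qed.

(** * Hoeffding's lemma and independent samples *)

Section hoeffding.
Import numFieldNormedType.Exports.
Context (R : realType).
Implicit Types u t x : R.

Lemma is_derive_le0_nonincr (f df : R -> R) t : 0 <= t ->
  (forall x, is_derive x 1 f (df x)) ->
  (forall x, 0 <= x -> df x <= 0) -> f t <= f 0.
Proof.
move=> t0 fdf df0.
have cf : {within `[0, t], continuous f}.
  apply: continuous_subspaceT => x; apply: differentiable_continuous.
  by apply/derivable1_diffP; exact: ex_derive.
have [c c0t fE] := MVT_segment t0 (fun x _ => fdf x) cf.
rewrite -subr_le0 fE subr0 mulr_le0_ge0//; apply: df0.
by move: c0t; rewrite in_itv/= => /andP[].
Qed.

Lemma is_derive_expRN x : is_derive x 1 (fun y : R => expR (- y)) (- expR (- x)).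
Proof.
have -> : - expR (- x) = expR (- x) * (-1) by rewrite mulrN1.
apply: (@is_derive1_comp _ expR (fun y : R => - y)).
Qed.

Section bernoulli_mgf.
Variable u : R.
Hypothesis u01 : 0 <= u <= 1.

(** [D] is the Laplace transform of a Bernoulli variable of mean [u], and [p x] is its mean after
    tilting by [e^(-x Y)]. Thus [D' = - p D], and [p' = - p (1 - p)] is minus the tilted
    variance. *)
Let D x : R := 1 - u + u * expR (- x).
Let p x : R := u * expR (- x) / D x.

Let D_gt0 x : 0 < D x.
Proof.
case/andP: u01 => u0 u1; have e0 := expR_gt0 (- x).
rewrite /D; have [->|u0'] := eqVneq u 0; first by rewrite subr0 mul0r addr0.
by rewrite ltr_wpDl ?subr_ge0// mulr_gt0// lt0r u0' u0.
Qed.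

Let is_derive_D x : is_derive x 1 D (- (u * expR (- x))).
Proof.
have := is_derive_expRN x => de.
have h : is_derive x 1 (fun y : R => (1 - u) + u *: expR (- y)) (0 + u *: - expR (- x)).
  exact: is_deriveD.
rewrite /D; apply: is_derive_eq h _.
by rewrite add0r scalerN.
Qed.

Let is_derive_p x : is_derive x 1 p (- p x + p x ^+ 2).
Proof.
have dD := is_derive_D x; have de := is_derive_expRN x.
have D0 : D x != 0 by rewrite gt_eqF.
have dV := is_deriveV D0 dD.
have dM : is_derive x 1 ((fun y : R => expR (- y)) * (fun y => (D y)^-1)) _ := is_deriveM de dV.
have h : is_derive x 1 (u \*: ((fun y : R => expR (- y)) * (fun y => (D y)^-1))) _ := is_deriveZ u dM.
have pE : p = u \*: ((fun y : R => expR (- y)) * (fun y => (D y)^-1)).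
  by apply/funext => y; rewrite /p /= -mulrA.
rewrite [X in is_derive _ _ X]pE; apply: is_derive_eq h _.
by rewrite /p /GRing.scale/=; field; exact: D0.
Qed.

(** A Bernoulli variance is at most 1/4, so [p] decreases from [p 0 = u] with slope at least
    -1/4. *)
Let p_ge x : 0 <= x -> u - x / 4 - p x <= 0.
Proof.
move=> x0; pose k (y : R) : R := u - 4^-1 * y - p y.
have dk (y : R) : is_derive y (1 : R) k (- 4^-1 - (- p y + p y ^+ 2)).
  have dp := is_derive_p y.
  have h : is_derive y (1 : R) ((cst u - 4^-1 \*: id) - p)
      ((0 - 4^-1 *: (1 : R)) - (- p y + p y ^+ 2)) by apply: is_deriveB.
  by apply: is_derive_eq h _; rewrite /GRing.scale/= mulr1 sub0r.
have k0 : k 0 = 0.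
  by rewrite /k /p /D oppr0 expR0 mulr0 mulr1 subrK divr1 subr0 subrr.
have := is_derive_le0_nonincr _ _ x x0 dk.
rewrite k0 /k (mulrC _ x); apply => y _; have := sqr_ge0 (p y - 2^-1); nra.
Qed.

(** The quotient [G] of the two sides starts at 1, and its derivative [G y * (u - y / 4 - p y)] is
    nonpositive by [p_ge]. The 1/8 is half the variance bound 1/4. *)
Lemma bernoulli_mgf_le t : 0 <= t ->
  (1 - u + u * expR (- t)) * expR (t * u) <= expR (t ^+ 2 / 8).
Proof.
move=> t0; pose G (y : R) : R := D y * expR (u * y - 8^-1 * y ^+ 2).
have dG (y : R) : is_derive y (1 : R) G
    (D y * expR (u * y - 8^-1 * y ^+ 2) * (u - y / 4 - p y)).
  have dD := is_derive_D y.
  have dq : is_derive y (1 : R) (u \*: id - 8^-1 \*: (id ^+ 2))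
      (u *: (1 : R) - 8^-1 *: ((2%:R * (id y) ^+ 1) *: (1 : R))) by apply: is_deriveB.
  have dE := is_derive1_comp (is_derive_expR _) dq.
  have h := is_deriveM dD dE.
  have GE : G = D * (expR \o (u \*: id - 8^-1 \*: (id ^+ 2))).
    by apply/funext => z.
  rewrite [X in is_derive _ _ X]GE; apply: is_derive_eq h _.
  have D0 : D y != 0 by rewrite gt_eqF.
  by rewrite /p /GRing.scale/=; field; exact: D0.
have := is_derive_le0_nonincr _ _ t t0 dG.
have G0 : G 0 = 1.
  by rewrite /G /D oppr0 expR0 mulr1 subrK mul1r mulr0 expr0n/= mulr0 subr0 expR0.
rewrite G0.
move=> Gt; have {}Gt : G t <= 1.
  apply: Gt => y y0; rewrite mulr_ge0_le0 ?p_ge//.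
  by rewrite mulr_ge0 ?expR_ge0// ltW.
rewrite -[leRHS]mul1r -ler_pdivrMr ?expR_gt0// -mulrA -expRB.
by move: Gt; rewrite /G /D; congr (_ * expR _ <= _); ring.
Qed.

End bernoulli_mgf.
End hoeffding.

(* Combine the tangent inequalities of expR at - t y, evaluated at 0 and - t. *)
Lemma expR_chord (R : realType) (t y : R) : 0 <= y <= 1 ->
  expR (- (t * y)) <= 1 - y + y * expR (- t).
Proof.
move=> /andP[y0 y1]; set z := - (t * y).
have h a : expR z * (1 + (a - z)) <= expR a.
  rewrite -[in leRHS](subrK z a) expRD mulrC.
  by rewrite ler_wpM2r ?expR_ge0// expR_ge1Dx.
have y1' : 0 <= 1 - y by rewrite subr_ge0.
have := lerD (ler_wpM2l y1' (h 0)) (ler_wpM2l y0 (h (- t))).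
rewrite expR0 mulr1; congr (_ <= _); rewrite /z; ring.
Qed.

Section pac_bayes_tools.
Local Open Scope ereal_scope.

Lemma bounded_integrable d (T : measurableType d) (R : realType)
    (P : probability T R) (f : T -> R) (B : R) :
  measurable_fun setT f -> (forall x, `|f x| <= B)%R ->
  P.-integrable setT (EFin \o f).
Proof.
move=> mf fB; have iB : P.-integrable setT (cst B%:E).
  exact: finite_measure_integrable_cst.
apply: (le_integrable measurableT _ _ iB); first exact/measurable_EFinP.
by move=> x _; rewrite /= lee_fin (le_trans (fB x))// ler_norm.
Qed.

Lemma integral_unit_itv d (T : measurableType d) (R : realType)
    (P : probability T R) (f : T -> R) :
  measurable_fun setT f -> (forall x, 0 <= f x <= 1)%R ->
  P.-integrable setT (EFin \o f) /\ 0 <= \int[P]_x (f x)%:E <= 1.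
Proof.
move=> mf f01; split.
  apply: (bounded_integrable _ _ _ _ _ 1) => // x.
  by case/andP: (f01 x) => f0 f1; rewrite ger0_norm.
apply/andP; split.
  by apply: integral_ge0 => x _; rewrite lee_fin; case/andP: (f01 x).
rewrite -[leRHS](@integral_probability_cst _ _ _ P); apply: ge0_le_integral => //.
- by move=> x _; rewrite lee_fin; case/andP: (f01 x).
- exact/measurable_EFinP.
- by move=> x _; rewrite lee_fin; case/andP: (f01 x).
Qed.

(** The chord of [y -> e^(- t y)] over [0, 1] bounds the integrand by the affine function [a + b Y],
    whose integral depends on the mean [u] only; this reduces to a Bernoulli variable of the same
    mean. *)
Lemma hoeffding d (T : measurableType d) (R : realType)
    (P : probability T R) (Y : T -> R) (t : R) :
  measurable_fun setT Y -> (forall x, 0 <= Y x <= 1)%R -> (0 <= t)%R ->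
  \int[P]_x (expR (t * (fine (\int[P]_y (Y y)%:E) - Y x)))%:E
    <= (expR (t ^+ 2 / 8))%:E.
Proof.
move=> mY Y01 t0; have [iY IY01] := integral_unit_itv d T R P Y mY Y01.
set u := fine _.
have uE : \int[P]_y (Y y)%:E = u%:E by rewrite fineK// integrable_fin_num.
have u01 : (0 <= u <= 1)%R by rewrite -!lee_fin -uE.
pose a := expR (t * u); pose b := (expR (t * u) * (expR (- t) - 1))%R.
have ia : P.-integrable setT (cst a%:E) by exact: finite_measure_integrable_cst.
have ib : P.-integrable setT (fun x => b%:E * (Y x)%:E).
  exact: (integrableZl measurableT b iY).
apply: (@le_trans _ _ (\int[P]_x (a%:E + b%:E * (Y x)%:E))).
  apply: ge0_le_integral => //.
  - apply/measurable_EFinP; apply: measurableT_comp => //.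
    by apply: measurable_funM => //; exact: measurable_funB.
  - apply/measurable_EFinP; apply: measurable_funD => //.
    exact: measurable_funM.
  - move=> x _; rewrite -EFinM -EFinD lee_fin mulrBr expRD.
    rewrite (_ : a + b * Y x = expR (t * u) * (1 - Y x + Y x * expR (- t)))%R; last first.
      by rewrite /a /b; ring.
    by rewrite ler_wpM2l ?expR_ge0// expR_chord.
rewrite integralD// integral_probability_cst integralZl// uE -EFinM -EFinD lee_fin.
apply: le_trans (bernoulli_mgf_le _ _ u01 _ t0).
by rewrite /a /b le_eqVlt; apply/orP; left; apply/eqP; ring.
Qed.

Lemma integral_tuple_prob_prod d (T : measurableType d) (R : realType)
    (P : probability T R) (n : nat) (g : T -> R) (c : R) :
  measurable_fun setT g -> (forall x, 0 <= g x)%R ->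
  \int[P]_x (g x)%:E = c%:E ->
  \int[tuple_prob n (fun=> P)]_t (\prod_(i < n) g (tnth t i))%:E = (c ^+ n)%:E.
Proof.
move=> mg g0 gc.
have c0 : (0 <= c)%R.
  by rewrite -lee_fin -gc integral_ge0// => x _; rewrite lee_fin.
have mprod m : measurable_fun [set: m.-tuple T]
    (fun t : m.-tuple T => \prod_(i < m) g (tnth t i))%R.
  apply: measurable_prod => i _.
  by apply: (measurableT_comp mg); exact: measurable_tnth.
have prod0 m (t : m.-tuple T) : (0 <= \prod_(i < m) g (tnth t i))%R.
  by apply: prodr_ge0 => i _.
elim: n => [|n IHn].
  under eq_integral do rewrite big_ord0.
  by rewrite integral_probability_cst expr0.
rewrite ge0_integral_tuple_probS; last 2 first.
- by apply/measurable_EFinP; exact: mprod.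
- by move=> t; rewrite lee_fin prod0.
transitivity (\int[P]_x ((g x)%:E * (c ^+ n)%:E)).
  apply: eq_integral => x _.
  under eq_integral.
    move=> t _; rewrite big_ord_recl /consT/= tnth0 EFinM.
    under eq_bigr do rewrite tnthS.
    over.
  rewrite ge0_integralZl_EFin//; last by apply/measurable_EFinP; exact: mprod.
  - by rewrite IHn.
  - by move=> t _; rewrite lee_fin prod0.
rewrite ge0_integralZr//=; last 3 first.
- exact/measurable_EFinP.
- by move=> x _; rewrite lee_fin.
- by rewrite lee_fin exprn_ge0.
by rewrite gc exprS EFinM.
Qed.

Lemma integral_tuple_prob_prod_le d (T : measurableType d) (R : realType)
    (P : probability T R) (n : nat) (g : T -> R) (c : R) :
  measurable_fun setT g -> (forall x, 0 <= g x)%R ->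
  \int[P]_x (g x)%:E <= c%:E ->
  \int[tuple_prob n (fun=> P)]_t (\prod_(i < n) g (tnth t i))%:E <= (c ^+ n)%:E.
Proof.
move=> mg g0 gc; have I0 : 0 <= \int[P]_x (g x)%:E.
  by apply: integral_ge0 => x _; rewrite lee_fin.
have IE : \int[P]_x (g x)%:E = (fine (\int[P]_x (g x)%:E))%:E.
  by rewrite fineK// ge0_fin_numE// (le_lt_trans gc)// ltry.
rewrite (integral_tuple_prob_prod _ _ _ _ _ _ _ mg g0 IE) lee_fin.
have fc : (fine (\int[P]_x (g x)%:E) <= c)%R by rewrite -lee_fin -IE.
have f0 : (0 <= fine (\int[P]_x (g x)%:E))%R by rewrite fine_ge0.
by rewrite lerXn2r// nnegrE (le_trans f0 fc).
Qed.

(** The indicator of the event is the product of the coordinate indicators, each of integral 1. *)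
Lemma tuple_prob_all d (T : measurableType d) (R : realType)
    (P : probability T R) (n : nat) (X : set T) :
  measurable X -> P X = 1 ->
  measurable [set t : n.-tuple T | forall i, X (tnth t i)] /\
  tuple_prob n (fun=> P) [set t : n.-tuple T | forall i, X (tnth t i)] = 1.
Proof.
move=> mX PX; set B := [set t | _].
have mB : measurable B.
  have -> : B = \bigcap_(i in [set: 'I_n]) ((@tnth _ T)^~ i @^-1` X).
    by apply/seteqP; split => [t Bt i _|t Bt i]; [exact: Bt|exact: (Bt i)].
  apply: fin_bigcap_measurable => // i _; rewrite -[X in measurable X]setTI.
  exact: measurable_tnth.
split=> //.
rewrite -[B in LHS]setIT -integral_indic//.
transitivity (\int[tuple_prob n (fun=> P)]_t (\prod_(i < n) \1_X (tnth t i))%:E : \bar R).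
  apply: eq_integral => t _; congr EFin; rewrite indicE.
  case: (boolP (t \in B)) => [|tB].
    by rewrite inE => Bt; rewrite big1// => i _; rewrite indicE mem_set.
  have [i Xi] : exists i, ~ X (tnth t i).
    by apply/existsNP => Bt; move: tB; rewrite notin_setE; apply.
  by rewrite (bigD1 i)//= indicE memNset// mul0r.
rewrite (@integral_tuple_prob_prod _ _ _ P n (\1_X) 1%R) ?expr1n//.
by rewrite integral_indic// setIT.
Qed.

Lemma ge0_markov d (T : measurableType d) (R : realType)
    (P : probability T R) (W : T -> \bar R) (a delta : R) :
  (0 < a)%R -> (0 < delta)%R ->
  measurable_fun setT W -> (forall x, 0 <= W x) ->
  \int[P]_x W x <= a%:E ->
  measurable [set x | W x <= (a / delta)%:E] /\
  (1 - delta)%:E <= P [set x | W x <= (a / delta)%:E].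
Proof.
move=> a0 delta0 mW W0 Wa; set A := [set x | _].
have mA : measurable A.
  by rewrite -[A]setTI; exact: emeasurable_fun_infty_c.
split=> //; have ad0 : (0 < a / delta)%R by rewrite divr_gt0.
have : (a / delta)%:E * P (~` A) <= a%:E.
  apply: (le_trans _ Wa); rewrite -[~` A]setIT -integral_indic//; last exact: measurableC.
  rewrite -ge0_integralZl_EFin//; last 2 first.
  - by apply/measurable_EFinP; apply: measurable_indic; exact: measurableC.
  - exact: ltW.
  apply: ge0_le_integral => //.
  - by move=> x _; rewrite mule_ge0// ?lee_fin// ltW.
  - apply: emeasurable_funM => //; apply/measurable_EFinP.
    by apply: measurable_indic; exact: measurableC.
  - move=> x _; rewrite indicE; case: (boolP (x \in ~` A)) => xA.
      by rewrite mule1; move: xA; rewrite inE/= => /negP; rewrite -ltNge => /ltW.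
    by rewrite mule0.
rewrite probability_setC// -(@fineK _ (P A)) ?fin_num_measure//.
rewrite -EFinB -EFinM !lee_fin => h.
have : ((1 - fine (P A)) <= delta)%R.
  have h2 : (a / delta * (1 - fine (P A)) <= a / delta * delta)%R by rewrite divfK ?gt_eqF.
  by rewrite ler_pM2l in h2.
lra.
Qed.

End pac_bayes_tools.

(** * The PAC-Bayes bound *)

(** Since the grid starts at 1, [a] is rounded to [truncn a + 1]. This leaves the grid only at the
    endpoint [a = n], which is itself a grid point. *)
Lemma grid_point (R : realType) (n : nat) (a : R) : (0 < n)%N -> 0 <= a <= n%:R ->
  exists j : 'I_n, `|a - j.+1%:R| <= 1.
Proof.
move=> n0 /andP[a0 an]; have /andP[ta at1] := truncn_itv a0.
have [tn|nt] := ltnP (Num.truncn a) n.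
  exists (Ordinal tn) => /=; rewrite ler_norml; apply/andP; split; last lra.
  by rewrite -natr1; lra.
have n1n : (n.-1 < n)%N by rewrite prednK.
exists (Ordinal n1n) => /=; rewrite prednK//.
have na : n%:R <= a by rewrite (le_trans _ ta)// ler_nat.
have -> : a = n%:R by apply/eqP; rewrite eq_le an na.
by rewrite subrr normr0.
Qed.

Section pac_bayes.
Local Open Scope ereal_scope.
Context dT dX (Theta : measurableType dT) (X : measurableType dX) (R : realType).
Variables (P : probability X R) (P0 : probability Theta R).
Variable (l : Theta * X -> R).
Hypotheses (ml : measurable_fun [set: Theta * X] l)
  (l01 : forall z, (0 <= l z <= 1)%R).
Variable n : nat.
Hypothesis n0 : (0 < n)%N.

Let r (q : Theta) : R := fine (\int[P]_x (l (q, x))%:E).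
Let rhat (S : n.-tuple X) (q : Theta) : R :=
  (n%:R^-1 * \sum_(i < n) l (q, tnth S i))%R.

Let ml2 q : measurable_fun [set: X] (fun x => l (q, x)).
Proof. exact: measurableT_comp. Qed.

Let rE q : \int[P]_x (l (q, x))%:E = (r q)%:E.
Proof.
have [il _] := integral_unit_itv _ _ _ P _ (ml2 q) (fun x => l01 (q, x)).
by rewrite fineK// integrable_fin_num.
Qed.

Let mr : measurable_fun [set: Theta] r.
Proof.
apply/measurable_EFinP; have -> : EFin \o r = fubini_F P (EFin \o l).
  by apply/funext => q; rewrite /= -rE.
apply: measurable_fun_fubini_tonelli_F; first exact/measurable_EFinP.
by move=> z; rewrite lee_fin; case/andP: (l01 z).
Qed.

Let r01 q : (0 <= r q <= 1)%R.
Proof.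
have [_] := integral_unit_itv _ _ _ P _ (ml2 q) (fun x => l01 (q, x)).
by rewrite rE !lee_fin.
Qed.

Let nR0 : (0 < n%:R :> R)%R. Proof. by rewrite ltr0n. Qed.

Let rhat01 S q : (0 <= rhat S q <= 1)%R.
Proof.
rewrite /rhat; apply/andP; split.
  rewrite mulr_ge0 ?invr_ge0 ?ler0n//; apply: sumr_ge0 => i _.
  by case/andP: (l01 (q, tnth S i)).
rewrite ler_pdivrMl// mulr1.
have -> : (n%:R = \sum_(i < n) 1 :> R)%R by rewrite sumr_const card_ord.
by apply: ler_sum => i _; case/andP: (l01 (q, tnth S i)).
Qed.

Let mrhat2 : measurable_fun [set: Theta * n.-tuple X]
  (fun z : Theta * n.-tuple X => rhat z.2 z.1).
Proof.
apply: measurable_funM => //; apply: measurable_sum => i.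
apply: (measurableT_comp ml); apply/measurable_fun_pairP; split; first exact: measurable_fst.
exact: (measurableT_comp (@measurable_tnth _ X n i)
  (@measurable_snd _ _ Theta (n.-tuple X))).
Qed.

Let mrhat S : measurable_fun [set: Theta] (rhat S).
Proof. exact: (measurableT_comp mrhat2 (pair2_measurable S)). Qed.

Let F (lam : R) (z : Theta * n.-tuple X) : \bar R :=
  (expR (lam * (r z.1 - rhat z.2 z.1)))%:E.

Let mF lam : measurable_fun [set: Theta * n.-tuple X] (F lam).
Proof.
apply/measurable_EFinP; apply: measurableT_comp => //.
apply: measurable_funM => //; apply: measurable_funB => //.
exact: measurableT_comp.
Qed.

Let F0 lam z : 0 <= F lam z.
Proof. by rewrite lee_fin expR_ge0. Qed.

Let Pn : probability (n.-tuple X) R := tuple_prob n (fun=> P).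
Let M lam : n.-tuple X -> \bar R := fubini_G P0 (F lam).

(** As the prior does not depend on the sample, Tonelli moves the sample integral inside. For fixed
    [q] the exponential splits into [n] independent factors with parameter [lam / n], and
    Hoeffding's lemma gives [n (lam / n)^2 / 8] in the exponent. *)
Let M_le lam : (0 <= lam)%R ->
  \int[Pn]_S M lam S <= (expR (lam ^+ 2 / (8 * n%:R)))%:E.
Proof.
move=> lam0; rewrite /M /fubini_G -fubini_tonelli//.
rewrite -[leRHS](@integral_probability_cst _ _ _ P0).
apply: ge0_le_integral => //.
- by move=> q _; apply: integral_ge0.
- exact: measurable_fun_fubini_tonelli_F.
move=> q _.
have FE S : F lam (q, S) =
    (\prod_(i < n) expR (lam / n%:R * (r q - l (q, tnth S i))))%:E.
  rewrite /F/= -expR_sum -mulr_sumr; congr (expR _)%:E.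
  rewrite sumrB sumr_const card_ord -[(r q *+ n)%R]mulr_natl /rhat.
  by field; rewrite gt_eqF.
under eq_integral do rewrite FE.
have -> : expR (lam ^+ 2 / (8 * n%:R)) = (expR ((lam / n%:R) ^+ 2 / 8) ^+ n)%R.
  rewrite -expRM_natl; congr expR; field; by rewrite gt_eqF.
apply: (@integral_tuple_prob_prod_le _ _ _ P n (fun x => expR (lam / n%:R * (r q - l (q, x))))).
- apply: measurableT_comp => //; apply: measurable_funM => //.
  exact: measurable_funB.
- by move=> x; rewrite expR_ge0.
- by apply: hoeffding => //; rewrite divr_ge0.
Qed.

(* The exponential moments are controlled on the grid lam = 4 j, j = 1..n:
   for a mean deviation x in [0, 1] the optimal lam is 4 n x, and
   rounding n x to an integer j costs 2 (n x - j)^2 / n <= 2. *)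
Let W S : \bar R :=
  \sum_(j < n) (expR (- (2 * j.+1%:R ^+ 2 / n%:R)))%:E * M (4 * j.+1%:R) S.

(** The weights in [W] are the reciprocals of the bounds of [M_le]: at [lam = 4 k] the exponent is
    [(4 k)^2 / (8 n) = 2 k^2 / n]. Each grid point thus contributes at most 1. *)
Let W_le : \int[Pn]_S W S <= n%:R%:E.
Proof.
have mM lam : measurable_fun [set: n.-tuple X] (M lam).
  exact: measurable_fun_fubini_tonelli_G.
have M0 lam S : 0 <= M lam S by exact: integral_ge0.
rewrite ge0_integral_sum//; last 2 first.
- by move=> j; apply: emeasurable_funM.
- by move=> j S _; rewrite mule_ge0// lee_fin expR_ge0.
apply: (@le_trans _ _ (\sum_(j < n) 1%:E)); last first.
  by rewrite sumEFin sumr_const card_ord.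
apply: lee_sum => j _; rewrite ge0_integralZl_EFin//.
have lam0 : (0 <= 4 * j.+1%:R :> R)%R by rewrite mulr_ge0.
apply: (@le_trans _ _ ((expR (- (2 * j.+1%:R ^+ 2 / n%:R)))%:E *
  (expR ((4 * j.+1%:R) ^+ 2 / (8 * n%:R)))%:E)).
  by rewrite lee_wpmul2l ?lee_fin ?expR_ge0// M_le.
rewrite -EFinM lee_fin -expRD -[leRHS]expR0 ler_expR.
by rewrite le_eqVlt; apply/orP; left; apply/eqP; field; rewrite gt_eqF.
Qed.

Let pac_bayes_sub (c : R) (S : n.-tuple X) (Q : probability Theta R) (K : R) :
  (0 < c)%R -> W S <= c%:E -> kl_le P0 Q K ->
  let x := (fine (\int[Q]_q (r q)%:E) - fine (\int[Q]_q (rhat S q)%:E))%R in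
  (0 <= x -> 2 * n%:R * x ^+ 2 <= K + ln c + 2)%R.
Proof.
move=> c0 WS kl x x0.
have [ir /andP[ir0 ir1]] := integral_unit_itv _ _ _ Q _ mr r01.
have [ih /andP[ih0 ih1]] := integral_unit_itv _ _ _ Q _ (mrhat S) (rhat01 S).
have irE : \int[Q]_q (r q)%:E = (fine (\int[Q]_q (r q)%:E))%:E.
  by rewrite fineK// integrable_fin_num.
have ihE : \int[Q]_q (rhat S q)%:E = (fine (\int[Q]_q (rhat S q)%:E))%:E.
  by rewrite fineK// integrable_fin_num.
have idE : Q.-integrable setT (fun q => (r q - rhat S q)%:E).
  exact: (integrableB measurableT ir ih).
have dE : \int[Q]_q (r q - rhat S q)%:E = x%:E.
  by rewrite integralB_EFin// irE ihE.
have x1 : (x <= 1)%R.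
  move: ir1 ih0; rewrite irE ihE !lee_fin /x; lra.
have /andP an : (0 <= n%:R * x)%R /\ (n%:R * x <= n%:R)%R.
  by split; [rewrite mulr_ge0|rewrite ler_piMr].
have [j hj] := grid_point _ _ _ n0 an.
set k : R := j.+1%:R in hj.
(* All terms of [W] are nonnegative, so a bound on the sum bounds the term of the grid point picked
   for this [Q]. *)
have Mj : M (4 * k) S <= (c * expR (2 * k ^+ 2 / n%:R))%:E.
  have : (expR (- (2 * k ^+ 2 / n%:R)))%:E * M (4 * k) S <= c%:E.
    apply: le_trans WS; rewrite /W (bigD1 j)//= leeDl// sume_ge0// => i _.
    by rewrite mule_ge0 ?lee_fin ?expR_ge0// integral_ge0.
  set b := (2 * k ^+ 2 / n%:R)%R => hM.
  have -> : M (4 * k) S = (expR b)%:E * ((expR (- b))%:E * M (4 * k) S).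
    by rewrite muleA -EFinM -expRD subrr expR0 mul1e.
  by rewrite (mulrC c) EFinM lee_wpmul2l// lee_fin expR_ge0.
have idl : Q.-integrable setT (EFin \o (fun q => 4 * k * (r q - rhat S q))%R).
  exact: (integrableZl measurableT (4 * k)%R idE).
have := donsker_varadhan _ _ _ P0 Q K (c * expR (2 * k ^+ 2 / n%:R))
  (fun q => 4 * k * (r q - rhat S q))%R kl idl _ Mj.
rewrite mulr_gt0 ?expR_gt0// => /(_ isT).
under eq_integral do rewrite EFinM.
rewrite integralZl// dE -EFinM lee_fin lnM ?posrE ?expR_gt0// expRK => h.
have hj2 : ((n%:R * x - k) ^+ 2 <= n%:R)%R.
  apply: (@le_trans _ _ 1%R); last by rewrite ler1n.
  by rewrite -[(_ ^+ 2)%R]real_normK ?num_real// expr_le1.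
have h2 : (2 * (n%:R * x - k) ^+ 2 / n%:R <= 2)%R.
  by rewrite ler_pdivrMr// ler_pM2l.
(* Completing the square: [h] bounds [4 k x - 2 k^2 / n] by [K + ln c], and the remaining square is
   the rounding cost bounded in [h2]. *)
have -> : (2 * n%:R * x ^+ 2 = 4 * k * x - 2 * k ^+ 2 / n%:R
    + 2 * (n%:R * x - k) ^+ 2 / n%:R)%R by field; rewrite gt_eqF.
lra.
Qed.

(** Markov's inequality puts [W] below [n / delta] outside an event of probability at most [delta],
    whence the logarithm; the added 2 is the rounding cost. The event is defined by [W], before any
    [Q] is chosen. *)
Theorem pac_bayes (delta : R) : (0 < delta)%R ->
  exists A : set (n.-tuple X),
    [/\ measurable A, (1 - delta)%:E <= tuple_prob n (fun=> P) A &
    forall S, A S -> forall (Q : probability Theta R) (K : R), kl_le P0 Q K ->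
      \int[Q]_q \int[P]_x (l (q, x))%:E <=
      \int[Q]_q (n%:R^-1 * \sum_(i < n) l (q, tnth S i))%:E
      + (Num.sqrt ((K + ln (n%:R / delta) + 2) / (2 * n%:R)))%:E].
Proof.
move=> delta0.
have mW : measurable_fun [set: n.-tuple X] W.
  apply: emeasurable_sum => j; apply: emeasurable_funM => //.
  exact: measurable_fun_fubini_tonelli_G.
have W0 S : 0 <= W S.
  by apply: sume_ge0 => j _; rewrite mule_ge0 ?lee_fin ?expR_ge0// integral_ge0.
have [mA PA] := ge0_markov _ _ _ Pn W _ _ nR0 delta0 mW W0 W_le.
exists [set S | W S <= (n%:R / delta)%:E]; split => // S AS Q K kl.
under eq_integral do rewrite rE.
have [ir _] := integral_unit_itv _ _ _ Q _ mr r01.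
have [ih _] := integral_unit_itv _ _ _ Q _ (mrhat S) (rhat01 S).
rewrite -[leLHS]fineK ?integrable_fin_num//.
rewrite -[X in _ <= X + _]fineK; last exact: integrable_fin_num ih.
rewrite -EFinD lee_fin -lerBlDl.
have nd0 : (0 < n%:R / delta)%R by rewrite divr_gt0.
have := pac_bayes_sub _ S Q K nd0 AS kl; rewrite /=.
set x := (fine _ - fine _)%R; set B := (K + _ + _)%R => h.
(* The grid argument covers nonnegative deviations; a negative one is below any root. *)
have [x0|/ltW x0] := leP 0%R x; last by rewrite (le_trans x0)// sqrtr_ge0.
rewrite -[leLHS](ger0_norm x0) -sqrtr_sqr ler_wsqrtr//.
by rewrite ler_pdivlMr ?mulr_gt0// mulrC h.
Qed.

End pac_bayes.

(** * Comparison of the single PAC-Bayes root with the sum of two roots *)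

Section cterm_bounds.
Context (R : realType).
Implicit Types s sigma delta : R.

Lemma normal_kl_ge0 s sigma : 0 < s -> 0 < sigma ->
  0 <= s ^+ 2 / sigma ^+ 2 + ln (sigma ^+ 2 / s ^+ 2) - 1.
Proof.
move=> s0 sigma0; set t := s ^+ 2 / sigma ^+ 2.
have t0 : 0 < t by rewrite divr_gt0// exprn_gt0.
have -> : sigma ^+ 2 / s ^+ 2 = t^-1 by rewrite invf_div.
rewrite lnV ?posrE//; have := expR_ge1Dx (ln t); rewrite lnK ?posrE//; lra.
Qed.

(** Equivalent to [e^(-1/2) >= 1/2], the tangent inequality at -1/2. It provides [4 ln 2 >= 2],
    which pays for the rounding cost. *)
Lemma ln2_ge_half : 2^-1 <= ln (2 : R).
Proof.
have e0 : 0 < expR 2^-1 :> R by exact: expR_gt0.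
rewrite -ler_expR lnK ?posrE//.
have := expR_ge1Dx (- 2^-1 : R); rewrite expRN => h.
have h2 : (1 - 2^-1) * expR 2^-1 <= 1 :> R by rewrite -ler_pdivlMr// div1r.
lra.
Qed.

(** Four copies of the logarithm amount to [4 ln 2 + 2 ln n - 4 ln delta], to be compared with
    [2 + ln n - ln delta]; here [ln n >= 0] and [ln delta < 0]. *)
Lemma ln_slack (n : nat) delta : (0 < n)%N -> 0 < delta < 1 ->
  0 <= ln (2 * Num.sqrt n%:R / delta) /\
  ln (n%:R / delta) + 2 <= 4 * ln (2 * Num.sqrt n%:R / delta).
Proof.
move=> n0 /andP[d0 d1]; have nR0 : 0 < n%:R :> R by rewrite ltr0n.
have sn0 : 0 < Num.sqrt n%:R :> R by rewrite sqrtr_gt0.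
have lnn : ln n%:R = 2 * ln (Num.sqrt n%:R) :> R.
  by rewrite -[in LHS](sqr_sqrtr (ltW nR0)) lnXn// mulr_natl.
have n1 : 0 <= ln n%:R :> R by rewrite ln_ge0// ler1n.
have ld : ln delta < 0 by rewrite ln_lt0// d0.
rewrite !ln_div ?posrE ?mulr_gt0// lnM ?posrE// lnn.
by have := ln2_ge_half; split; lra.
Qed.

(* Each root is at least sqrt (L / (2n)), so squaring the sum produces
   an extra 2L / (2n) on top of (K1 + K2 + 2L) / (2n). *)
Lemma sqrt_split (K1 K2 L B m : R) : 0 <= K1 -> 0 <= K2 -> 0 <= L -> 0 < m ->
  B <= 4 * L ->
  Num.sqrt ((K1 + K2 + B) / m) <=
  Num.sqrt ((K1 + L) / m) + Num.sqrt ((K2 + L) / m).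
Proof.
move=> K10 K20 L0 m0 BL.
have Lm0 : 0 <= L / m by rewrite divr_ge0// ltW.
have a0 : 0 <= (K1 + L) / m by rewrite divr_ge0 ?addr_ge0// ltW.
have b0 : 0 <= (K2 + L) / m by rewrite divr_ge0 ?addr_ge0// ltW.
have aL : Num.sqrt (L / m) <= Num.sqrt ((K1 + L) / m).
  by rewrite ler_wsqrtr// ler_pM2r ?invr_gt0// lerDr.
have bL : Num.sqrt (L / m) <= Num.sqrt ((K2 + L) / m).
  by rewrite ler_wsqrtr// ler_pM2r ?invr_gt0// lerDr.
have ab : L / m <= Num.sqrt ((K1 + L) / m) * Num.sqrt ((K2 + L) / m).
  by rewrite -[leLHS](sqr_sqrtr Lm0) expr2 ler_pM.
rewrite -[leRHS]ger0_norm ?addr_ge0// -sqrtr_sqr ler_wsqrtr//.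
rewrite sqrrD !sqr_sqrtr// -mulr_natl.
apply: (@le_trans _ _ ((K1 + K2 + 4 * L) / m)).
  by rewrite ler_pM2r ?invr_gt0// lerD2l.
have -> : (K1 + K2 + 4 * L) / m = (K1 + L) / m + 2 * (L / m) + (K2 + L) / m.
  by rewrite !mulrDl; ring.
lra.
Qed.

End cterm_bounds.

(** * Isotropic Gaussians on tuples and their divergence *)

Section gauss_exp_theory.
Local Open Scope ereal_scope.
Context (R : realType).

Definition gauss_prob (N : nat) (m : N.-tuple R) (s : R) :
    probability (N.-tuple (measurableTypeR R)) R :=
  tuple_prob N (fun k => normal_prob (nth 0%R m k) s).

(** Closed form of the divergence of N(m, s^2 I) from N(m0, sigma^2 I); divided by [2n] it gives the
    first two terms under the root of [cterm]. *)
Definition gauss_kl (N : nat) (m m0 : N.-tuple R) (s sigma : R) : R :=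
  (sqdist m m0 / (2 * sigma ^+ 2)
   + N%:R * (s ^+ 2 / sigma ^+ 2 + ln (sigma ^+ 2 / s ^+ 2) - 1) / 2)%R.

Lemma kl_le_gauss N (m m0 : N.-tuple R) s sigma :
  (0 < s)%R -> (0 < sigma)%R ->
  kl_le (gauss_prob N m0 sigma) (gauss_prob N m s) (gauss_kl N m m0 s sigma).
Proof.
move=> s0 sigma0.
pose K k := ((nth 0 m k - nth 0 m0 k) ^+ 2 / (2 * sigma ^+ 2)
     + (s ^+ 2 / sigma ^+ 2 + ln (sigma ^+ 2 / s ^+ 2) - 1) / 2)%R.
have -> : gauss_kl N m m0 s sigma = (\sum_(k < N) K k)%R.
  rewrite big_split/= sumr_const card_ord /gauss_kl; congr (_ + _)%R.
    rewrite /sqdist mulr_suml; apply: eq_bigr => i _.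
    by rewrite !(tnth_nth 0%R).
  by rewrite -[RHS]mulr_natl mulrA.
apply: kl_le_tuple_prob => k; exact: kl_le_normal.
Qed.

Lemma gauss_kl_ge0 N (m m0 : N.-tuple R) s sigma :
  (0 < s)%R -> (0 < sigma)%R -> (0 <= gauss_kl N m m0 s sigma)%R.
Proof.
move=> s0 sigma0; apply: addr_ge0; apply: divr_ge0 => //.
- by apply: sumr_ge0 => i _; exact: sqr_ge0.
- by rewrite pmulr_rge0// sqr_ge0.
- by rewrite mulr_ge0// normal_kl_ge0.
Qed.

Lemma ctermE N n (m m0 : N.-tuple R) s sigma delta :
  (0 < n)%N -> (0 < s)%R -> (0 < sigma)%R ->
  cterm n m m0 s sigma delta =
  Num.sqrt ((gauss_kl N m m0 s sigma + ln (2 * Num.sqrt n%:R / delta))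
            / (2 * n%:R))%R.
Proof.
move=> n0 s0 sigma0; rewrite /cterm /gauss_kl; congr Num.sqrt.
set k := (_ + _ - 1)%R; set L := ln _.
have nR0 : (n%:R != 0 :> R)%R by rewrite pnatr_eq0 -lt0n.
by field; rewrite nR0 gt_eqF.
Qed.

Lemma gauss_expE N (m : N.-tuple R) s (f : N.-tuple R -> \bar R) :
  measurable_fun [set: N.-tuple (measurableTypeR R)] f -> (forall t, 0 <= f t) ->
  gauss_exp m s f = \int[gauss_prob N m s]_t f t.
Proof. exact: (iintE _ (measurableTypeR R)). Qed.

Lemma gauss_exp2E N1 N2 (m1 : N1.-tuple R) (m2 : N2.-tuple R) s1 s2
    (f : N1.-tuple R * N2.-tuple R -> \bar R) :
  measurable_fun
    [set: N1.-tuple (measurableTypeR R) * N2.-tuple (measurableTypeR R)] f ->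
  (forall t, 0 <= f t) ->
  gauss_exp m1 s1 (fun p => gauss_exp m2 s2 (fun q => f (p, q))) =
  \int[gauss_prob N1 m1 s1 \x gauss_prob N2 m2 s2]_t f t.
Proof.
move=> mf f0; rewrite fubini_tonelli1//.
rewrite -[RHS]gauss_expE; last 2 first.
- exact: measurable_fun_fubini_tonelli_F.
- by move=> p; apply: integral_ge0.
congr gauss_exp; apply/funext => p; rewrite gauss_expE//.
exact: measurableT_comp.
Qed.

End gauss_exp_theory.

Lemma probability_setI_full d (T : measurableType d) (R : realType)
    (P : probability T R) (A B : set T) :
  measurable A -> measurable B -> P B = 1%E -> (P A <= P (A `&` B))%E.
Proof.
move=> mA mB PB; have mAB : measurable (A `&` B) by exact: measurableI.
have mBC : measurable (~` B) by exact: measurableC.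
apply: (@le_trans _ _ (P ((A `&` B) `|` ~` B))).
  apply: le_measure; rewrite ?inE//; first exact: measurableU.
  by move=> x Ax; have [Bx|nBx] := pselect (B x); [left|right].
apply: (le_trans (measureU2 _ mAB mBC)).
by rewrite [X in (_ + X)%E]probability_setC// PB subee// adde0.
Qed.

Lemma measurable_fun_extend0 d (T : measurableType d) (R : realType)
    (D : set T) (f : T -> R) :
  measurable D -> measurable_fun D f ->
  measurable_fun setT (fun x => if x \in D then f x else 0).
Proof.
move=> mD mf; apply/measurable_EFinP.
have -> : EFin \o (fun x => if x \in D then f x else 0) = (EFin \o f) \_ D.
  by apply/funext => x; rewrite patchE /=; case: ifPn.
by apply/(measurable_restrictT _ _).1 => //; exact/measurable_EFinP.
Qed.

Lemma measurable_snd_preimage d1 d2 (T1 : measurableType d1)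
    (T2 : measurableType d2) (X : set T2) :
  measurable X -> measurable [set z : T1 * T2 | X z.2].
Proof.
by move=> mX; rewrite -[X in measurable X]setTI; exact: (measurable_snd measurableT).
Qed.

Theorem theorem3 (R : realType) (D : nat) (X : set (D.-tuple R))
  (mX : measurable X) (P : probability (D.-tuple R) R) (PX : P X = 1%E)
  (n : nat) (n_gt0 : (0 < n)%N)
  (Nphi Ntheta : nat) (Nphi_gt0 : (0 < Nphi)%N) (Ntheta_gt0 : (0 < Ntheta)%N)
  (loss : Nphi.-tuple R -> Ntheta.-tuple R -> D.-tuple R -> R)
  (loss_meas : measurable_fun
     [set z : (Nphi.-tuple R * Ntheta.-tuple R) * D.-tuple R | X z.2]
     (fun z => loss z.1.1 z.1.2 z.2))
  (loss01 : forall p q x, X x -> 0 <= loss p q x <= 1)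
  (delta : R) (delta01 : 0 < delta < 1)
  (phi0 : Nphi.-tuple R) (theta0 : Ntheta.-tuple R)
  (sigphi sigtheta : R) (sigphi_gt0 : 0 < sigphi) (sigtheta_gt0 : 0 < sigtheta) :
  exists A : set (n.-tuple (D.-tuple R)),
    [/\ measurable A,
        ((1 - delta)%:E <= sample_prob P A)%E &
        forall S, A S ->
        forall (phi : Nphi.-tuple R) (theta : Ntheta.-tuple R) (sphi stheta : R),
          0 < sphi -> 0 < stheta ->
          (gauss_exp phi sphi (fun p =>
             gauss_exp theta stheta (fun q => risk P X loss p q))
           <= gauss_exp phi sphi (fun p =>
                gauss_exp theta stheta (fun q => emp_risk loss S p q))
              + (cterm n phi phi0 sphi sigphi delta)%:E
              + (cterm n theta theta0 stheta sigtheta delta)%:E)%E].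
Proof.
have /andP[d0 d1] := delta01.
(* The loss is only constrained on X: extend it by 0, and restrict the good
   event to samples in X. *)
pose l : (Nphi.-tuple (measurableTypeR R) * Ntheta.-tuple (measurableTypeR R))
    * D.-tuple R -> R :=
  fun z => if z \in [set z | X z.2] then loss z.1.1 z.1.2 z.2 else 0.
have lE p q x : X x -> l ((p, q), x) = loss p q x.
  by move=> Xx; rewrite /l mem_set.
have l01 z : 0 <= l z <= 1.
  rewrite /l; case: ifPn => [|_]; last by rewrite lexx ler01.
  by rewrite inE/= => Xz; exact: loss01.
have ml : measurable_fun setT l.
  by apply: measurable_fun_extend0 => //; 
  exact: (@measurable_snd_preimage _ _ (Nphi.-tuple (measurableTypeR R) *
    Ntheta.-tuple (measurableTypeR R))%type (D.-tuple R) X mX).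
have [A [mA PA HA]] := @pac_bayes _ _ _ _ R P
  (gauss_prob R Nphi phi0 sigphi \x gauss_prob R Ntheta theta0 sigtheta)%E
  l ml l01 n n_gt0 delta d0.
have [mB PB] := tuple_prob_all _ _ R P n X mX PX.
set B := [set t | _] in mB PB.
exists (A `&` B); split; first exact: measurableI.
  rewrite /sample_prob /sample_exp (iintE _ _ _ n (fun=> P)).
  - rewrite integral_indic// ?setIT; last exact: measurableI.
    exact: le_trans PA (probability_setI_full _ _ _ _ _ _ mA mB PB).
  - by apply/measurable_EFinP; apply: measurable_indic; exact: measurableI.
  - by move=> t; rewrite lee_fin.
move=> S [AS BS] phi theta sphi stheta sphi0 stheta0.
(* Encoder and decoder weights form one parameter with product prior and product posterior, so one
   PAC-Bayes bound with the sum of the divergences serves both. *)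
have kl := kl_le_prod _ _ _ _ _ _ _ _ _ _ _
  (kl_le_gauss R Nphi phi phi0 sphi sigphi sphi0 sigphi_gt0)
  (kl_le_gauss R Ntheta theta theta0 stheta sigtheta stheta0 sigtheta_gt0).
have := HA S AS _ _ kl.
have mlx x : measurable_fun setT (fun z => l (z, x)) by exact: measurableT_comp.
rewrite -gauss_exp2E; last 2 first.
- apply: (@measurable_fun_fubini_tonelli_F _ _ _ _ _ P (EFin \o l)).
    exact/measurable_EFinP.
  by move=> z; rewrite lee_fin; case/andP: (l01 z).
- by move=> z; apply: integral_ge0 => x _; rewrite lee_fin; case/andP: (l01 (z, x)).
rewrite -gauss_exp2E; last 2 first.
- apply/measurable_EFinP; apply: measurable_funM => //.
  by apply: measurable_sum => i; exact: mlx.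
- move=> z; rewrite lee_fin mulr_ge0 ?invr_ge0//; apply: sumr_ge0 => i _.
  by case/andP: (l01 (z, tnth S i)).
have -> : (fun p => gauss_exp theta stheta (fun q => risk P X loss p q)) =
    (fun p => gauss_exp theta stheta (fun q => \int[P]_x (l (p, q, x))%:E))%E.
  apply/funext => p; congr gauss_exp; apply/funext => q.
  rewrite /risk integral_mkcond; apply: eq_integral => x _.
  rewrite patchE /l; have [Xx|nXx] := pselect (X x); first by rewrite !mem_set.
  by rewrite !memNset.
have -> : (fun p => gauss_exp theta stheta (fun q => emp_risk loss S p q)) =
    (fun p => gauss_exp theta stheta (fun q =>
      (n%:R^-1 * \sum_(i < n) l (p, q, tnth S i))%:E)).
  apply/funext => p; congr gauss_exp; apply/funext => q.
  rewrite /emp_risk; congr (_ * _)%:E.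
  by apply: eq_bigr => i _; rewrite lE//; exact: BS.
move=> H; apply: (le_trans H); rewrite -addeA leeD2l// -EFinD lee_fin !ctermE//.
have [L0 LB] := ln_slack R n delta n_gt0 delta01.
(* Grouping [ln (n / delta) + 2] as the [B] of [sqrt_split]; [LB] is the required [B <= 4 L]. *)
rewrite -(addrA (_ + _)); apply: sqrt_split => //.
- exact: gauss_kl_ge0.
- exact: gauss_kl_ge0.
- by rewrite mulr_gt0// ltr0n.
Qed.
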